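(* Let $a,b>0$ be real numbers with $a^2+b^2<4$. Put $$d=\sqrt{4-a^{2}-b^{2}},\qquad p=a+b+2,$$ $$\gamma=\arctan\left(\frac{p+\sqrt{2b^{2}+4b}}{d}\right),\qquad \phi=\arctan\left(\frac{d}{p}\right),\qquad \phi_{a}=\arctan\left(\frac{d}{a}\right).$$ Then $$2Cl_{2}(2\gamma+2\phi_{a}-\pi)+2Cl_{2}(2\gamma+2\phi-\pi)+Cl_{2}(2\phi_{a}-4\phi)-2Cl_{2}(2\gamma-2\phi+2\phi_{a}-\pi)$$ $$+2Cl_{2}(\pi-2\gamma)+Cl_{2}(4\phi)-Cl_{2}(2\phi_{a})-4Cl_{2}(2\phi)=0.$$
   Context: $Cl_2$ denotes the Clausen function on $\mathbb{R}$: $Cl_{2}(x)=-\int_{0}^{x}\log\left(2\left|\sin\frac{\varphi}{2}\right|\right)d\varphi=\sum_{n=1}^{\infty}\frac{\sin(nx)}{n^{2}}$. Here $\arctan$ takes values in $(-\pi/2,\pi/2)$. *)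

(* Defs.v *)
From mathcomp Require Import all_boot all_order all_algebra.
From mathcomp Require Import all_classical all_reals all_analysis.

Set Implicit Arguments.
Unset Strict Implicit.
Unset Printing Implicit Defensive.

Import Order.TTheory GRing.Theory Num.Theory.
Import numFieldNormedType.Exports.

Local Open Scope classical_set_scope.
Local Open Scope ring_scope.

Definition oriented_integral (R : realType) (a b : R) (f : R -> R) : R :=
  if a <= b then \int[@lebesgue_measure R]_(t in `[a, b]) f t
  else - \int[@lebesgue_measure R]_(t in `[b, a]) f t.

(* The integrand has logarithmic, hence Lebesgue integrable, singularities at
   the multiples of 2 pi; the library's value ln 0 = 0 at these points only
   affects a null set. *)
Definition Cl2 (R : realType) (x : R) : R :=
  - oriented_integral 0 x (fun phi => ln (2 * `|sin (phi / 2)|)).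

(* Main.v *)
(* Keep a and p fixed and let t = d run from 0 to its actual value, with
   s(t) = sqrt(p^2 - 2ap - t^2); at the end point s^2 = 2b^2 + 4b, and
   delta = pi/2 - gamma = arctan(t/(p+s)).  At t = 0 the angles phi, phi_a,
   delta all vanish, hence so do all the arguments of Cl2.  Along the path the
   derivative of the combination is linear in phi', phi_a', delta', and each of
   the three coefficients is zero: it is the logarithm of a product of sines,
   which equals 1 because of the relation s^2 = p^2 - 2ap - t^2. *)
Require Import Defs.
From mathcomp Require Import all_boot all_order all_algebra.
From mathcomp Require Import all_classical all_reals all_analysis.
From mathcomp Require Import measurable_realfun ring lra.

Set Implicit Arguments.
Unset Strict Implicit.
Unset Printing Implicit Defensive.

Import Order.TTheory GRing.Theory Num.Theory.
Import numFieldNormedType.Exports.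

Local Open Scope ring_scope.
Local Open Scope classical_set_scope.

(** * Integrability of the inverse square root at 0 *)

Lemma continuous_invsqrt (R : realType) (x : R) : 0 < x ->
  {for x, continuous (fun y : R => (Num.sqrt y)^-1)}.
Proof.
move=> x0; apply: cvgV; first by rewrite gt_eqF// sqrtr_gt0.
exact: sqrt_continuous.
Qed.

Lemma measurable_invsqrt (R : realType) (c : R) :
  measurable_fun `[0, c] (fun y : R => (Num.sqrt y)^-1).
Proof.
apply/measurable_fun_itv_obnd_cbndP.
have sub : `]0, c] `<=` `]0, +oo[ by apply: subset_itvl; rewrite bnd_simp.
apply: (measurable_funS _ sub) => //.
apply: open_continuous_measurable_fun; first exact: interval_open.
by move=> x; rewrite inE/= in_itv/= andbT; exact: continuous_invsqrt.
Qed.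

Lemma integral_invsqrt (R : realType) (e c : R) : 0 < e < c ->
  (\int[@lebesgue_measure R]_(x in `[e, c]) ((Num.sqrt x)^-1)%:E =
   (2 * Num.sqrt c)%:E - (2 * Num.sqrt e)%:E)%E.
Proof.
move=> /andP[e0 ec].
have cs : continuous (fun y : R => 2 * Num.sqrt y).
  by move=> x; apply: cvgM; [exact: cvg_cst|exact: sqrt_continuous].
have d2 (x : R) : 0 < x ->
    is_derive x 1 (fun y : R => 2 * Num.sqrt y) (Num.sqrt x)^-1.
  move=> x0; have := is_derive1_sqrt x0 => ?.
  apply: is_derive_eq; rewrite /GRing.scale/=.
  by rewrite invfM mulrA divff ?mul1r.
rewrite (@continuous_FTC2 _ _ (fun y : R => 2 * Num.sqrt y))//.
- apply: continuous_in_subspaceT => x; rewrite inE/= in_itv/= => /andP[ex _].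
  by apply: continuous_invsqrt; exact: lt_le_trans ex.
- split.
  + by move=> x; rewrite in_itv/= => /andP[ex _]; case: (d2 x (lt_trans e0 ex)).
  + exact/cvg_at_right_filter/cs.
  + exact/cvg_at_left_filter/cs.
- move=> x; rewrite in_itv/= => /andP[ex _]; rewrite derive1E.
  by case: (d2 x (lt_trans e0 ex)).
Qed.

(** Monotone convergence along segments exhausting []0, c]]: on each of them the integral is at most
    [2 * Num.sqrt c]. This function will dominate the logarithmic singularity. *)
Lemma integrable_invsqrt (R : realType) (c : R) : 0 < c ->
  (@lebesgue_measure R).-integrable `[0, c] (EFin \o (fun x => (Num.sqrt x)^-1)).
Proof.
move=> c0.
have mf : measurable_fun `[0, c] (EFin \o (fun x : R => (Num.sqrt x)^-1)).
  by apply/measurable_EFinP; exact: measurable_invsqrt.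
apply/integrableP; split => //.
under eq_integral do rewrite /= ger0_norm ?invr_ge0 ?sqrtr_ge0//.
(* With [n.+2] instead of [n.+1] the left end is strictly below [c] already for [n = 0], as
   [integral_invsqrt] demands. *)
pose F (n : nat) : set R := `[c / n.+2%:R, c].
have cn n : 0 < c / n.+2%:R < c.
  by rewrite divr_gt0//= ltr_pdivrMr// ltr_pMr// ltr1n.
have FU : \bigcup_n F n = `]0, c].
  apply/seteqP; split => x /=.
    move=> [n _]; rewrite /F/= !in_itv/= => /andP[nx ->]; rewrite andbT.
    by case/andP: (cn n) => ? _; exact: lt_le_trans nx.
  (* For this [n] one has [c / x < n + 1], hence [c / (n + 2) <= x]. *)
  rewrite in_itv/= => /andP[x0 xc]; exists (Num.truncn (c / x)) => //.
  rewrite /F/= in_itv/= xc andbT ler_pdivrMr// mulrC -ler_pdivrMr//.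
  apply: ltW; apply: (lt_le_trans (truncnS_gt _)).
  by rewrite ler_nat.
have sF n : F n `<=` `[0, c].
  move=> x; rewrite /F/= !in_itv/= => /andP[nx ->]; rewrite andbT.
  by case/andP: (cn n) => /ltW + _ => /le_trans; apply.
have mF n : measurable (F n) by exact: measurable_itv.
rewrite -integral_itv_obnd_cbnd -?FU; last first.
  by apply: measurable_funS mf => // x [n _ /sF].
apply: (@le_lt_trans _ _ (2 * Num.sqrt c)%:E); last exact: ltry.
have nF : {homo F : n m / (n <= m)%N >-> (n <= m)%O}.
  apply/nondecreasing_seqP => n; rewrite subsetEset => x.
  rewrite /F/= !in_itv/= => /andP[nx ->]; rewrite andbT (le_trans _ nx)//.
  by rewrite ler_pM2l// lef_pV2 ?posrE// ler_nat.
have mFf n : measurable_fun (F n) (fun x => ((Num.sqrt x)^-1)%:E).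
  exact: measurable_funS mf.
have f0 n x : F n x -> (0 <= ((Num.sqrt x)^-1)%:E)%E.
  by rewrite lee_fin invr_ge0 sqrtr_ge0.
have := ge0_nondecreasing_set_cvg_integral (mu := @lebesgue_measure R) nF mF mFf f0.
move=> /cvge_to_le; apply.
apply: nearW => n; rewrite integral_invsqrt// -EFinB lee_fin.
by rewrite gerBl mulr_ge0// sqrtr_ge0.
Qed.

(** * Elementary bounds for the sine and the logarithm *)

(** The difference [sin x - x * cos x] vanishes at 0 and has derivative [x * sin x], which is
    nonnegative on [[0, pi]]. *)
Lemma mulr_cos_le_sin (R : realType) (y : R) : 0 <= y <= pi -> y * cos y <= sin y.
Proof.
move=> /andP[y0 ypi].
have df (x : R) : is_derive x 1 (fun x : R => sin x - x * cos x) (x * sin x).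
  apply: is_derive_eq; rewrite /GRing.scale/=; ring.
have [|c] := @MVT_segment _ _ (fun x => x * sin x) 0 y y0 (fun x _ => df x).
  by apply: derivable_within_continuous => x _; case: (df x).
rewrite in_itv/= => /andP[c0 cy] h.
rewrite -subr_ge0; move: h; rewrite sin0 mul0r !subr0 => ->.
by rewrite !mulr_ge0// sin_ge0_pi// c0 (le_trans cy).
Qed.

(** With [y = x / 2]: [sin x = 2 sin y cos y >= 2 y cos^2 y = y (1 + cos x) >= y], since
    [cos x >= 0]. *)
Lemma half_le_sin (R : realType) (x : R) : 0 <= x <= pi / 2 -> x / 2 <= sin x.
Proof.
move=> /andP[x0 xpi]; have pi0 := @pi_gt0 R.
have cx : 0 <= cos x by rewrite cos_ge0_pihalf//; apply/andP; split; lra.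
have cy : 0 <= cos (x / 2) by rewrite cos_ge0_pihalf//; apply/andP; split; lra.
have ys : x / 2 * cos (x / 2) <= sin (x / 2).
  by apply: mulr_cos_le_sin; apply/andP; split; lra.
set y := x / 2 in cy ys *.
have xE : x = y + y by rewrite /y; field.
move: cx; rewrite xE sinD cosD => cx.
have := cos2Dsin2 y; rewrite !expr2 => cs.
have y0 : 0 <= y by rewrite divr_ge0.
have : y * cos y * cos y <= sin y * cos y by rewrite ler_wpM2r.
have : 0 <= y * (2 * (cos y * cos y) - 1) by rewrite mulr_ge0//; lra.
lra.
Qed.

(** Meant for [y = 2 sin (x / 2)]. With [s = Num.sqrt x <= 2], from below [- ln y <= 2 ln (1 / s) +
    ln 2 <= 2 / s + 1 <= 4 / s]; from above [ln y <= y - 1 <= 1 <= 2 / s]. *)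
Lemma normr_ln_le (R : realType) (x y : R) : 0 < x <= 4 -> x / 2 <= y <= 2 ->
  `|ln y| <= 4 / Num.sqrt x.
Proof.
move=> /andP[x0 x4] /andP[xy y2].
have y0 : 0 < y by lra.
set s := Num.sqrt x.
have s0 : 0 < s by rewrite sqrtr_gt0.
have ss : s ^+ 2 = x by rewrite sqr_sqrtr// ltW.
have s2 : s <= 2 by rewrite -(@ler_pXn2r _ 2)// ?nnegrE ?(ltW s0)// ss; lra.
have is2 : 2^-1 <= s^-1 by rewrite lef_pV2 ?posrE.
have is0 : 0 < s^-1 by rewrite invr_gt0.
rewrite ler_norml; apply/andP; split.
  have : ln y >= ln (x / 2) by rewrite ler_ln// posrE//; lra.
  have : ln (x / 2) = - (2 * ln s^-1 + ln 2).
    rewrite ln_div ?posrE// lnV ?posrE// -ss lnXn// -mulr_natr; ring.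
  have := ln_sublinear is0; have := @ln_sublinear R 2 ltac:(lra).
  have := @le_ln1Dx R 1 ltac:(lra).
  have -> : 1 + 1 = 2 :> R by lra.
  lra.
have : ln y <= 1.
  have -> : y = 1 + (y - 1) by lra.
  by apply: le_trans (le_ln1Dx _) _; lra.
lra.
Qed.

(** * The integrand of the Clausen function and its primitive *)

Definition log2sin (R : realType) (x : R) : R := ln (2 * `|sin (x / 2)|).

Lemma continuous_log2sin (R : realType) (x : R) : sin (x / 2) != 0 ->
  {for x, continuous (@log2sin R)}.
Proof.
move=> sx.
have c1 : {for x, continuous (fun x : R => 2 * `|sin (x / 2)|)}.
  apply: cvgM; first exact: cvg_cst.
  apply: cvg_norm.
  apply: (@continuous_comp _ _ _ (fun x : R => x / 2) sin).
    by apply: cvgM; [exact: cvg_id|exact: cvg_cst].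
  exact: continuous_sin.
apply: (@continuous_comp _ _ _ _ (@ln R) _ c1).
by apply: continuous_ln; rewrite mulr_gt0// normr_gt0.
Qed.

Lemma measurable_log2sin (R : realType) : measurable_fun [set: R] (@log2sin R).
Proof.
apply: measurableT_comp => //.
apply: continuous_measurable_fun => x.
apply: cvgM; first exact: cvg_cst.
apply: cvg_norm.
apply: (@continuous_comp _ _ _ (fun x : R => x / 2) sin).
  by apply: cvgM; [exact: cvg_id|exact: cvg_cst].
exact: continuous_sin.
Qed.

(** Domination by [4 / Num.sqrt x]. The segment [[0, pi]] suffices because every argument of [Cl2]
    along the path stays in it. *)
Lemma integrable_log2sin (R : realType) :
  (@lebesgue_measure R).-integrable `[0, pi] (EFin \o @log2sin R).
Proof.
have pi0 := @pi_gt0 R; have pi4 := @pihalf_lt2 R.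
have mlog : measurable_fun `[(0 : R), pi] (EFin \o @log2sin R).
  by apply/measurable_EFinP; apply: measurable_funTS; exact: measurable_log2sin.
have : (@lebesgue_measure R).-integrable `[0, pi]
    (fun x => 4%:E * ((Num.sqrt x)^-1)%:E)%E.
  by apply: integrableZl => //; exact: integrable_invsqrt.
apply: le_integrable => // x /=; rewrite in_itv/= => /andP[x0 xpi].
rewrite lee_fin /log2sin.
(* At 0 the bound holds by the default value [ln 0 = 0]. *)
have [->|xn0] := eqVneq x 0.
  by rewrite mul0r sin0 normr0 mulr0 ln0// normr0.
have {xn0}x0 : 0 < x by rewrite lt_neqAle eq_sym xn0.
rewrite [leRHS]ger0_norm ?mulr_ge0 ?invr_ge0 ?sqrtr_ge0//.
have s1 := sin_le1 (x / 2).
have sx : x / 2 / 2 <= sin (x / 2) by apply: half_le_sin; apply/andP; split; lra.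
rewrite (ger0_norm (_ : 0 <= sin (x / 2))); last lra.
by apply: normr_ln_le; apply/andP; split; lra.
Qed.

Definition log2sin_primitive (R : realType) (x : R) : R :=
  \int[@lebesgue_measure R]_(t in `[0, x]) log2sin t.

Lemma Cl2E (R : realType) (x : R) : 0 <= x -> Cl2 x = - log2sin_primitive x.
Proof. by move=> x0; rewrite /Cl2 /oriented_integral x0. Qed.

(* Continuity is two-sided because the interval of integration is empty, and the
   primitive 0, for negative arguments; there it differs from - Cl2. *)
Lemma continuous_log2sin_primitive0 (R : realType) :
  {for 0, continuous (@log2sin_primitive R)}.
Proof.
have := parameterized_integral_cvg_left (@pi_gt0 R) (@integrable_log2sin R).
rewrite /prop_for /continuous_at {2}/log2sin_primitive.
by rewrite set_itv1 Rintegral_set1.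
Qed.

Lemma is_derive_log2sin_primitive (R : realType) (x : R) : 0 < x < pi ->
  is_derive x 1 (@log2sin_primitive R) (log2sin x).
Proof.
move=> /andP[x0 xpi].
have sx : sin (x / 2) != 0.
  by rewrite gt_eqF// sin_gt0_pi//; apply/andP; split; lra.
have [dF F'] := continuous_FTC1_closed xpi (@integrable_log2sin R) x0
  (continuous_log2sin sx).
by apply: DeriveDef => //; rewrite -derive1E.
Qed.

(** * Trigonometry of the three angles *)

(** Here [u] is the inverse hypotenuse of the right triangle with legs [t] and [q]; keeping it
    abstract makes all later sines polynomials, within reach of [ring]. *)
Lemma sin_cos_atan_div (R : realType) (t q : R) : 0 < q -> exists2 u : R, 0 < u &
  [/\ sin (atan (t / q)) = t * u, cos (atan (t / q)) = q * u &
      u ^+ 2 * (t ^+ 2 + q ^+ 2) = 1].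
Proof.
move=> q0; set x := atan _.
have cx : 0 < cos x by rewrite cos_gt0_pihalf// atan_gtNpi2 atan_ltpi2.
have qn0 : q != 0 by rewrite gt_eqF.
have sx : sin x = t / q * cos x.
  by rewrite -[t / q]atanK /tan divfK// gt_eqF.
exists (cos x / q); first exact: divr_gt0.
split; [by rewrite sx; field|by field|].
by rewrite -(cos2Dsin2 x) sx; field.
Qed.

Lemma log2sin_double (R : realType) (x : R) : 0 < sin x ->
  log2sin (2 * x) = ln (2 * sin x).
Proof.
move=> sx; rewrite /log2sin (_ : 2 * x / 2 = x); last by field.
by rewrite gtr0_norm.
Qed.

(** Lets the sign of a difference of arctangents be read off from a product formula for its sine. *)
Lemma sin_gt0_bounds (R : realType) (x : R) : - pi < x < pi / 2 -> 0 < sin x ->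
  0 < 2 * x < pi.
Proof.
move=> /andP[x1 x2] sx; suff x0 : 0 < x by apply/andP; split; lra.
rewrite ltNge; apply/negP => xle0; move: sx; apply/negP; rewrite -leNgt.
by rewrite -[x]opprK sinN oppr_le0 sin_ge0_pi//; apply/andP; split; lra.
Qed.

(* Here sin phi = t u and cos phi = p u, and likewise with v for phia and w for
   delta; the factor q = p + s - a is b + 2 + s in the theorem. *)
Lemma sin_angles (R : realType) (a p s t : R) :
  0 < a -> 0 < p -> 0 < s -> 0 < t -> s ^+ 2 = p ^+ 2 - 2 * a * p - t ^+ 2 ->
  let phi := atan (t / p) in let phia := atan (t / a) in
  let delta := atan (t / (p + s)) in
  let q := p + s - a in
  exists u v w : R, [/\ [/\ 0 < u, 0 < v, 0 < w, 0 < q & 2 * w ^+ 2 * p * q = 1],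
   [/\ sin (phia - delta) = t * v * w * q,
   sin (phi - delta) = t * u * w * s,
   sin (phia - 2 * phi) = t * v * u ^+ 2 * s ^+ 2 &
   sin (phia - phi - delta) = t * u * v * w * s * q] &
   [/\ sin delta = t * w, sin (2 * phi) = 2 * t * p * u ^+ 2,
   sin phia = t * v & sin phi = t * u]].
Proof.
move=> a0 p0 s0 t0 sE phi phia delta q.
have ps0 : 0 < p + s by lra.
have [u u0 [su cu u1]] := sin_cos_atan_div t p0.
have [v v0 [sv cv v1]] := sin_cos_atan_div t a0.
have [w w0 [sw cw w1]] := sin_cos_atan_div t ps0.
rewrite -/phi in su cu; rewrite -/phia in sv cv; rewrite -/delta in sw cw.
(* The relation for [s] reads [p * (p - 2 * a) = s ^+ 2 + t ^+ 2]. *)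
have p2a : 0 < p - 2 * a.
  rewrite -(pmulr_rgt0 _ p0) (_ : p * _ = s ^+ 2 + t ^+ 2); last by rewrite sE; ring.
  by rewrite addr_gt0// exprn_gt0.
have q0 : 0 < q by rewrite /q; lra.
exists u, v, w; split; split => //; rewrite /q.
(* The squared hypotenuse of [delta] factors: [t^2 + (p + s)^2 = 2 p (p + s - a)]. *)
- rewrite -[RHS]w1 (_ : (p + s) ^+ 2 = p ^+ 2 + s ^+ 2 + 2 * p * s); last by ring.
  by rewrite sE; ring.
- by rewrite sinB sv cv sw cw; ring.
- by rewrite sinB su cu sw cw; ring.
- rewrite mulr_natl sinB sin_mulr2n cos_mulr2n su cu sv cv sE.
  have -> : (p * u) ^+ 2 *+ 2 - 1 = (p ^+ 2 - t ^+ 2) * u ^+ 2.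
    by rewrite -u1; ring.
  by ring.
- rewrite sinB sinB cosB su cu sv cv sw cw.
  transitivity (t * u * v * w * (p ^+ 2 - 2 * a * p - t ^+ 2 + s * (p - a))).
    by ring.
  by rewrite -sE; ring.
- by rewrite mulr_natl sin_mulr2n su cu; ring.
Qed.

(** Places all eight arguments where [is_derive_log2sin_primitive] applies: the differences are
    positive because their sines are, and arctangents stay below [pi / 2]. *)
Lemma angles_in_range (R : realType) (a p s t : R) :
  0 < a -> 0 < p -> 0 < s -> 0 < t -> s ^+ 2 = p ^+ 2 - 2 * a * p - t ^+ 2 ->
  let phi := atan (t / p) in let phia := atan (t / a) in
  let delta := atan (t / (p + s)) in
  [/\ [/\ 0 < 2 * (phia - delta) < pi, 0 < 2 * (phi - delta) < pi,
      0 < 2 * (phia - 2 * phi) < pi & 0 < 2 * (phia - phi - delta) < pi] &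
   [/\ 0 < 2 * delta < pi, 0 < 2 * (2 * phi) < pi,
      0 < 2 * phia < pi & 0 < 2 * phi < pi]].
Proof.
move=> a0 p0 s0 t0 sE phi phia delta.
have [u [v [w [[u0 v0 w0 q0 _] [s1 s2 s3 s4] [s5 s6 s7 s8]]]]] :=
  sin_angles a0 p0 s0 t0 sE.
have gt0 x : 0 < x -> 0 < atan x by move=> x0; rewrite -atan0 lt_atan.
have phi0 : 0 < phi by rewrite gt0// divr_gt0.
have phia0 : 0 < phia by rewrite gt0// divr_gt0.
have delta0 : 0 < delta by rewrite gt0// divr_gt0// addr_gt0.
have phi1 : phi < pi / 2 := atan_ltpi2 _.
have phia1 : phia < pi / 2 := atan_ltpi2 _.
have delta1 : delta < pi / 2 := atan_ltpi2 _.
have pi0 := @pi_gt0 R.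
have r1 : 0 < 2 * (phia - delta) < pi.
  by apply: sin_gt0_bounds; [apply/andP; split; lra|rewrite s1 !mulr_gt0].
have r2 : 0 < 2 * (phi - delta) < pi.
  by apply: sin_gt0_bounds; [apply/andP; split; lra|rewrite s2 !mulr_gt0].
have r3 : 0 < 2 * (phia - 2 * phi) < pi.
  apply: sin_gt0_bounds; [apply/andP; split; lra|].
  by rewrite s3 !mulr_gt0 ?exprn_gt0.
have r4 : 0 < 2 * (phia - phi - delta) < pi.
  by apply: sin_gt0_bounds; [apply/andP; split; lra|rewrite s4 !mulr_gt0].
(* The bound [4 phi < pi] comes from [r3], which gives [2 phi < phia < pi / 2]. *)
by split; split => //; apply/andP; split; lra.
Qed.

(* The vanishing of the coefficients of delta', phia' and phi'. *)
Lemma log2sin_relations (R : realType) (a p s t : R) :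
  0 < a -> 0 < p -> 0 < s -> 0 < t -> s ^+ 2 = p ^+ 2 - 2 * a * p - t ^+ 2 ->
  let phi := atan (t / p) in let phia := atan (t / a) in
  let delta := atan (t / (p + s)) in
  [/\ log2sin (2 * (phia - delta)) + log2sin (2 * (phi - delta)) =
      log2sin (2 * (phia - phi - delta)) + log2sin (2 * delta),
   2 * log2sin (2 * (phia - delta)) + log2sin (2 * (phia - 2 * phi)) =
      2 * log2sin (2 * (phia - phi - delta)) + log2sin (2 * phia) &
   log2sin (2 * (phi - delta)) + log2sin (2 * (phia - phi - delta)) +
      log2sin (2 * (2 * phi)) =
      log2sin (2 * (phia - 2 * phi)) + 2 * log2sin (2 * phi)].
Proof.
move=> a0 p0 s0 t0 sE phi phia delta.
have [u [v [w [[u0 v0 w0 q0 wq] [s1 s2 s3 s4] [s5 s6 s7 s8]]]]] :=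
  sin_angles a0 p0 s0 t0 sE.
rewrite -/phi -/phia -/delta in s1 s2 s3 s4 s5 s6 s7 s8.
have Lpos (x y : R) : 0 < y -> sin x = y -> log2sin (2 * x) = ln (2 * y).
  by move=> y0 xy; rewrite log2sin_double xy.
rewrite (Lpos _ _ _ s1) ?(Lpos _ _ _ s2) ?(Lpos _ _ _ s3) ?(Lpos _ _ _ s4)
  ?(Lpos _ _ _ s5) ?(Lpos _ _ _ s6) ?(Lpos _ _ _ s7) ?(Lpos _ _ _ s8);
  try by rewrite ?mulr_gt0 ?exprn_gt0.
have sqln (x : R) : 0 < x -> 2 * ln x = ln (x ^+ 2).
  by move=> x0; rewrite lnXn// mulr_natl.
(* The first two products of sines agree as monomials; the third pair agrees up to the factor
   [2 w^2 p q = 1]. *)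
split; rewrite ?sqln -?lnM ?posrE ?mulr_gt0 ?exprn_gt0//;
  congr ln; [ring|ring|].
transitivity (8 * t ^+ 3 * u ^+ 4 * v * s ^+ 2 * (2 * w ^+ 2 * p * (p + s - a))).
  by ring.
by rewrite wq; ring.
Qed.

(** * Constancy of the combination along the path *)

Lemma derivable_continuous_at (R : realType) (f : R -> R) (x : R) :
  derivable f x 1 -> {for x, continuous f}.
Proof. by move=> df; exact/differentiable_continuous/derivable1_diffP. Qed.

(** Mere derivability is enough: the derivatives of the angles get multiplied by zero coefficients,
    so their values are never computed. *)
Lemma derivable_atan_div (R : realType) (h : R -> R) (t : R) :
  h t != 0 -> derivable h t 1 -> derivable (fun t : R => atan (t / h t)) t 1.
Proof.
move=> ht dh.
have d1 : is_derive t 1 h ('D_1 h t) by exact: DeriveDef.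
have d2 := is_deriveV ht d1.
have d3 := is_deriveM (is_derive_id t 1) d2.
by case: (@is_derive1_comp _ (@atan R) (fun t => t / h t) _ _ _
  (is_derive1_atan (t / h t)) d3).
Qed.

Lemma derivable_Dsqrt (R : realType) (p k t : R) : t ^+ 2 < k ->
  derivable (fun t : R => p + Num.sqrt (k - t ^+ 2)) t 1.
Proof.
move=> tk.
have k0 : 0 < k - t ^+ 2 by rewrite subr_gt0.
have d1 : is_derive t 1 (fun t : R => k - t ^+ 2) (- (2 * t)).
  by apply: is_derive_eq; rewrite /GRing.scale/=; ring.
have d2 := @is_derive1_comp _ (@Num.sqrt R) (fun t => k - t ^+ 2) _ _ _
  (is_derive1_sqrt k0) d1.
by have [] := is_deriveD (is_derive_cst p t 1) d2.
Qed.

(** The left-hand side of the theorem after [gamma = pi / 2 - delta], with [F] in place of [Cl2]; it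
    is used for [F = - Cl2]. *)
Definition clausen_combination (R : realType) (F : R -> R) (phi phia delta : R) :=
  2 * F (2 * (phia - delta)) + 2 * F (2 * (phi - delta))
  + F (2 * (phia - 2 * phi)) - 2 * F (2 * (phia - phi - delta))
  + 2 * F (2 * delta) + F (2 * (2 * phi)) - F (2 * phia) - 4 * F (2 * phi).

Lemma is_derive_clausen_path (R : realType) (a p k t : R) :
  0 < a -> 0 < p -> k = p ^+ 2 - 2 * a * p -> 0 < t -> t ^+ 2 < k ->
  is_derive t 1 (fun t : R => clausen_combination (@log2sin_primitive R)
    (atan (t / p)) (atan (t / a)) (atan (t / (p + Num.sqrt (k - t ^+ 2))))) 0.
Proof.
move=> a0 p0 kE t0 tk.
set s := Num.sqrt (k - t ^+ 2).
have k0 : 0 < k - t ^+ 2 by rewrite subr_gt0.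
have s0 : 0 < s by rewrite sqrtr_gt0.
have sE : s ^+ 2 = p ^+ 2 - 2 * a * p - t ^+ 2.
  by rewrite sqr_sqrtr ?(ltW k0)// kE.
have [[r1 r2 r3 r4] [r5 r6 r7 r8]] := angles_in_range a0 p0 s0 t0 sE.
have [e1 e2 e3] := log2sin_relations a0 p0 s0 t0 sE.
pose P (t : R) := atan (t / p); pose A (t : R) := atan (t / a).
pose D (t : R) := atan (t / (p + Num.sqrt (k - t ^+ 2))).
have dP : is_derive t 1 P ('D_1 P t).
  by apply: DeriveDef => //; apply: derivable_atan_div; rewrite ?gt_eqF.
have dA : is_derive t 1 A ('D_1 A t).
  by apply: DeriveDef => //; apply: derivable_atan_div; rewrite ?gt_eqF.
have dD : is_derive t 1 D ('D_1 D t).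
  apply: DeriveDef => //; apply: derivable_atan_div; first by rewrite gt_eqF ?addr_gt0.
  exact: derivable_Dsqrt.
have dJ (g : R -> R) (g' : R) : 0 < 2 * g t < pi -> is_derive t 1 g g' ->
    is_derive t 1 (fun x => log2sin_primitive (2 * g x)) (log2sin (2 * g t) * (2 * g')).
  move=> gt dg.
  exact: (@is_derive1_comp _ _ (fun x => 2 * g x) _ _ _
    (is_derive_log2sin_primitive gt) (is_deriveZ 2 dg)).
have h1 := dJ _ _ r1 (is_deriveB dA dD).
have h2 := dJ _ _ r2 (is_deriveB dP dD).
have d2P : is_derive t 1 (fun x => 2 * P x) (2 * 'D_1 P t) by apply: is_derive_eq.
have h3 := dJ _ _ r3 (is_deriveB dA d2P).
have h4 := dJ _ _ r4 (is_deriveB (is_deriveB dA dP) dD).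
have h5 := dJ _ _ r5 dD.
have h6 := dJ _ _ r6 d2P.
have h7 := dJ _ _ r7 dA.
have h8 := dJ _ _ r8 dP.
apply: is_derive_eq.
rewrite /GRing.scale/=.
set L1 := log2sin _; set L2 := log2sin _; set L3 := log2sin _.
set L4 := log2sin _; set L5 := log2sin _; set L6 := log2sin _.
set L7 := log2sin _; set L8 := log2sin _.
have {}e1 : L1 + L2 = L4 + L5 := e1.
have {}e2 : 2 * L1 + L3 = 2 * L4 + L7 := e2.
have {}e3 : L2 + L4 + L6 = L3 + 2 * L8 := e3.
(* Each relation is solved for a term of its own ([L5], [L7], [L6]); after substitution the
   coefficients of the three angle derivatives cancel identically. *)
have -> : L5 = L1 + L2 - L4 by rewrite e1; ring.
have -> : L7 = 2 * L1 + L3 - 2 * L4 by rewrite e2; ring.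
have -> : L6 = L3 + 2 * L8 - L2 - L4 by rewrite -e3; ring.
by ring.
Qed.

(** The derivative is available only for [t > 0], so the starting point of the path is treated
    apart: all arguments are 0 there, where the primitive is continuous. *)
Lemma continuous_clausen_path0 (R : realType) (a p k : R) :
  0 < a -> 0 < p -> 0 < k ->
  {for 0, continuous (fun t : R => clausen_combination (@log2sin_primitive R)
    (atan (t / p)) (atan (t / a)) (atan (t / (p + Num.sqrt (k - t ^+ 2)))))}.
Proof.
move=> a0 p0 k0.
pose P (t : R) := atan (t / p); pose A (t : R) := atan (t / a).
pose D (t : R) := atan (t / (p + Num.sqrt (k - t ^+ 2))).
have cP : P x @[x --> 0] --> P 0.
  apply: derivable_continuous_at; apply: derivable_atan_div => //.
  by rewrite gt_eqF.
have cA : A x @[x --> 0] --> A 0.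
  apply: derivable_continuous_at; apply: derivable_atan_div => //.
  by rewrite gt_eqF.
have cD : D x @[x --> 0] --> D 0.
  apply: derivable_continuous_at; apply: derivable_atan_div.
    by rewrite gt_eqF// ltr_wpDr// sqrtr_ge0.
  by apply: derivable_Dsqrt; rewrite expr0n.
have P0 : P 0 = 0 by rewrite /P mul0r atan0.
have A0 : A 0 = 0 by rewrite /A mul0r atan0.
have D0 : D 0 = 0 by rewrite /D mul0r atan0.
have cM (g : R -> R) : g x @[x --> 0] --> g 0 ->
    2 * g x @[x --> 0] --> 2 * g 0.
  by move=> cg; apply: cvgM => //; exact: cvg_cst.
have cJ (g : R -> R) : g 0 = 0 -> g x @[x --> 0] --> g 0 ->
    log2sin_primitive (2 * g x) @[x --> 0] --> log2sin_primitive (2 * g 0).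
  move=> g0 cg; apply: (@continuous_comp _ _ _ (fun x => 2 * g x)).
    exact: cM.
  by rewrite g0 mulr0; exact: continuous_log2sin_primitive0.
have h1 := cJ (fun x => A x - D x) _ (cvgB cA cD).
have h2 := cJ (fun x => P x - D x) _ (cvgB cP cD).
have h3 := cJ (fun x => A x - 2 * P x) _ (cvgB cA (cM _ cP)).
have h4 := cJ (fun x => A x - P x - D x) _ (cvgB (cvgB cA cP) cD).
have h6 := cJ (fun x => 2 * P x) _ (cM _ cP).
apply: cvgB; last first.
  by apply: cvgM; [exact: cvg_cst|exact: cJ].
apply: cvgB; last exact: cJ.
apply: cvgD; last by apply: h6; rewrite P0 mulr0.
apply: cvgD; last by apply: cvgM; [exact: cvg_cst|exact: cJ].
apply: cvgB; last first.
  by apply: cvgM; [exact: cvg_cst|apply: h4; rewrite A0 P0 D0 !subr0].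
apply: cvgD; last by apply: h3; rewrite A0 P0 mulr0 subr0.
apply: cvgD.
  by apply: cvgM; [exact: cvg_cst|apply: h1; rewrite A0 D0 subr0].
by apply: cvgM; [exact: cvg_cst|apply: h2; rewrite P0 D0 subr0].
Qed.

Lemma clausen_path_eq0 (R : realType) (a p k d : R) :
  0 < a -> 0 < p -> k = p ^+ 2 - 2 * a * p -> 0 < d -> d ^+ 2 < k ->
  clausen_combination (@log2sin_primitive R)
    (atan (d / p)) (atan (d / a)) (atan (d / (p + Num.sqrt (k - d ^+ 2)))) = 0.
Proof.
move=> a0 p0 kE d0 dk.
have k0 : 0 < k by apply: le_lt_trans dk; rewrite sqr_ge0.
set G := fun t : R => clausen_combination (@log2sin_primitive R)
    (atan (t / p)) (atan (t / a)) (atan (t / (p + Num.sqrt (k - t ^+ 2)))).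
(* Including [t = d] also yields the continuity at the right end that the mean value theorem asks
   for. *)
have dG (t : R) : 0 < t -> t <= d -> is_derive t 1 G 0.
  move=> t0 td; apply: is_derive_clausen_path => //.
  by apply: le_lt_trans dk; rewrite ler_pXn2r// nnegrE ltW.
have [||c _] := @MVT _ G (fun=> 0) 0 d d0.
- by move=> t; rewrite in_itv/= => /andP[t0 /ltW]; exact: dG.
- apply: continuous_in_subspaceT => t; rewrite inE/= in_itv/= => /andP[].
  rewrite le_eqVlt => /predU1P[<- _|t0 td]; first exact: continuous_clausen_path0.
  by apply: derivable_continuous_at; case: (dG t t0 td).
rewrite mul0r => /subr0_eq; rewrite -/(G d) => ->.
rewrite /G /clausen_combination !mul0r atan0 !(mulr0, subr0) /log2sin_primitive.
by rewrite set_itv1 Rintegral_set1; ring.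
Qed.

(** * Return to [gamma] and to [Cl2] *)

Lemma atan_div_swap (R : realType) (x y : R) : 0 < x -> 0 < y ->
  atan (x / y) = pi / 2 - atan (y / x).
Proof.
move=> x0 y0; have [u u0 [su cu _]] := sin_cos_atan_div y x0.
set z := atan (y / x) in su cu *.
have z0 : 0 < z by rewrite -atan0 lt_atan// divr_gt0.
have z1 : z < pi / 2 := atan_ltpi2 _.
rewrite -[RHS]tanK; last by rewrite in_itv/=; apply/andP; split; lra.
congr atan; rewrite /tan sinB cosB sin_pihalf cos_pihalf su cu.
by rewrite !mul0r !mul1r subr0 add0r; field; rewrite !gt_eqF.
Qed.

Local Close Scope classical_set_scope.

Theorem proposition1 (R : realType) (a b : R)
    (ha : 0 < a) (hb : 0 < b) (hab : a ^+ 2 + b ^+ 2 < 4) :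
  let d := Num.sqrt (4 - a ^+ 2 - b ^+ 2) in
  let p := a + b + 2 in
  let gamma := atan ((p + Num.sqrt (2 * b ^+ 2 + 4 * b)) / d) in
  let phi := atan (d / p) in
  let phi_a := atan (d / a) in
  2 * Cl2 (2 * gamma + 2 * phi_a - pi)
  + 2 * Cl2 (2 * gamma + 2 * phi - pi)
  + Cl2 (2 * phi_a - 4 * phi)
  - 2 * Cl2 (2 * gamma - 2 * phi + 2 * phi_a - pi)
  + 2 * Cl2 (pi - 2 * gamma)
  + Cl2 (4 * phi)
  - Cl2 (2 * phi_a)
  - 4 * Cl2 (2 * phi) = 0.
Proof.
move=> d p; set s := Num.sqrt _ => gamma phi phi_a.
have d2 : 0 < 4 - a ^+ 2 - b ^+ 2 by lra.
have d0 : 0 < d by rewrite sqrtr_gt0.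
have dd : d ^+ 2 = 4 - a ^+ 2 - b ^+ 2 by rewrite sqr_sqrtr// ltW.
have p0 : 0 < p by rewrite /p; lra.
have sgt : 0 < 2 * b ^+ 2 + 4 * b by rewrite addr_gt0// mulr_gt0// exprn_gt0.
have s0 : 0 < s by rewrite sqrtr_gt0.
(* Since [p (p - 2 a) = (b + 2)^2 - a^2], subtracting [d^2] removes [a]. *)
have kE : p ^+ 2 - 2 * a * p - d ^+ 2 = 2 * b ^+ 2 + 4 * b.
  by rewrite dd /p; ring.
have sE : s ^+ 2 = p ^+ 2 - 2 * a * p - d ^+ 2 by rewrite kE sqr_sqrtr// ltW.
have dk : d ^+ 2 < p ^+ 2 - 2 * a * p by rewrite -subr_gt0 kE.
have := clausen_path_eq0 ha p0 erefl d0 dk.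
rewrite kE -/s -/phi -/phi_a.
have [] := angles_in_range ha p0 s0 d0 sE.
rewrite -/phi -/phi_a.
set delta := atan (d / (p + s)).
have gE : gamma = pi / 2 - delta by rewrite /gamma atan_div_swap// addr_gt0.
(* The lower bounds feed [Cl2E], which turns each [Cl2] into minus the primitive. *)
move=> [/andP[/ltW r1 _] /andP[/ltW r2 _] /andP[/ltW r3 _] /andP[/ltW r4 _]].
move=> [/andP[/ltW r5 _] /andP[/ltW r6 _] /andP[/ltW r7 _] /andP[/ltW r8 _]].
have -> : 2 * gamma + 2 * phi_a - pi = 2 * (phi_a - delta) by rewrite gE; field.
have -> : 2 * gamma + 2 * phi - pi = 2 * (phi - delta) by rewrite gE; field.
have -> : 2 * phi_a - 4 * phi = 2 * (phi_a - 2 * phi) by ring.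
have -> : 2 * gamma - 2 * phi + 2 * phi_a - pi = 2 * (phi_a - phi - delta).
  by rewrite gE; field.
have -> : pi - 2 * gamma = 2 * delta by rewrite gE; field.
have -> : 4 * phi = 2 * (2 * phi) by ring.
rewrite !Cl2E// /clausen_combination => h.
by apply/eqP; rewrite -oppr_eq0 -[X in _ == X]h; apply/eqP; ring.
Qed.
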